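(* Let $n$ be a positive integer and let $M \in M_n(\mathbb D)$ be a square dual-numbered matrix. Then there exist matrices $U, \Sigma, V \in M_n(\mathbb D)$ such that $$M = U\Sigma V^T,$$ where $U^T U = V^T V = I$ and $\Sigma$ is a diagonal matrix.
   Context: The dual numbers are the commutative ring $\mathbb D = \mathbb R[\epsilon]/(\epsilon^2)$; every element is uniquely of the form $a+b\epsilon$ with $a,b\in\mathbb R$, and $\epsilon^2=0$. $M_n(\mathbb D)$ is the ring of $n\times n$ matrices over $\mathbb D$, and $V^T$ denotes the ordinary transpose (no conjugation). The diagonal entries of a diagonal matrix over $\mathbb D$ are arbitrary dual numbers. *)

(* Defs.v *)
From mathcomp Require Import all_boot all_order all_algebra qpoly reals.

Set Implicit Arguments.
Unset Strict Implicit.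
Unset Printing Implicit Defensive.

Import GRing.Theory.
Local Open Scope ring_scope.

(* The dual numbers R[eps]/(eps^2), as the library's quotient ring. That
   quotient falls back to {poly %/ 'X} when its argument is not monic of
   positive degree; [dual_sqr0] and [dual_repr] show that here it is the
   intended ring. *)
Notation dual R := {poly %/ ('X^2%R : {poly R})}.

Definition eps (R : realType) : dual R := 'qX.

Lemma dual_sqr0 (R : realType) : eps R ^+ 2 = 0.
Proof.
apply: val_inj; rewrite /eps /qpolyX -(rmorphXn (in_qpoly ('X^2 : {poly R}))) /=.
by rewrite mk_monic_Xn Pdiv.RingMonic.rmodpp ?monicXn.
Qed.

Lemma dual_repr (R : realType) (z : dual R) :
  exists! ab : R * R, z = ab.1%:A + ab.2 *: eps R.
Proof.
have epsE : eps R = 'X :> {poly R}.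
  by rewrite qpolyXE ?size_polyXn ?monicXn.
have coefE0 (a b : R) i :
    (a%:A + b *: eps R : dual R)`_i = a *+ (i == 0)%N + b *+ (i == 1)%N.
  rewrite poly_of_qpolyD !poly_of_qpolyZ epsE coefD !coefZ coefX coefC.
  by case: i => [|[|i]]; rewrite ?(mulr1, mulr0).
exists (z`_0, z`_1); split=> [|[a b] /= ->]; last first.
  by rewrite !coefE0 /= addr0 add0r.
apply/npolyP => i; rewrite coefE0 /=.
case: i => [|[|i]] /=; rewrite ?addr0 ?add0r // big_coef_npoly //.
by rewrite mk_monic_Xn size_polyXn.
Qed.

(* Main.v *)
Require Import Defs.
From mathcomp Require Import all_boot all_order all_algebra qpoly reals.
From mathcomp Require Import boolp classical_sets topology normedtype derive.
From mathcomp Require Import ring lra.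

Set Implicit Arguments.
Unset Strict Implicit.
Unset Printing Implicit Defensive.

Import Order.TTheory GRing.Theory Num.Theory numFieldNormedType.Exports.
Local Open Scope ring_scope.

(** Induction on [n]: peel off one singular triple [u M = l v], [v M^T = l u]
    with dual unit vectors [u], [v], complete [u] and [v] to orthogonal matrices
    by Householder reflections, and deflate.

    For [M = A + eps B] with [A != 0], let [H X := [0 X; X^T 0]].  The real
    matrix [H A] has an eigenvalue [s != 0]; to find a dual eigenvector of
    [H A + eps H B] lying over it, maximise the quadratic form of [H B] on the
    unit sphere of [ker (H A - s)].  The Lagrange condition at a maximiser is
    exactly the Fredholm solvability condition of the equation for the
    [eps]-part.  Since [s != 0] is invertible, the two halves of the eigenvector
    have the same dual norm, which is invertible and has a square root.  When
    [A = 0], factor [eps] out of [M] instead. *)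

(** * Quadratic forms and their maxima on the unit sphere of a kernel *)

Lemma trmx11 (T : Type) (A : 'M[T]_1) : A^T = A.
Proof. by apply/matrixP => i j; rewrite !ord1 mxE. Qed.

Definition bil {R : comNzRingType} {m} (B : 'M[R]_m) (z w : 'rV[R]_m) : R :=
  (z *m B *m w^T) 0 0.

Definition quad {R : comNzRingType} {m} (B : 'M[R]_m) (z : 'rV[R]_m) : R :=
  (z *m B *m z^T) 0 0.

Lemma quad1E (R : comNzRingType) m (z : 'rV[R]_m) :
  quad 1%:M z = \sum_i z 0 i ^+ 2.
Proof. by rewrite /quad mulmx1 mxE; apply: eq_bigr => i _; rewrite mxE expr2. Qed.

Lemma quad1_ge0 (R : realDomainType) m (z : 'rV[R]_m) : 0 <= quad 1%:M z.
Proof. by rewrite quad1E sumr_ge0 // => i _; exact: sqr_ge0. Qed.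

Lemma quad1_eq0 (R : realDomainType) m (z : 'rV[R]_m) :
  (quad 1%:M z == 0) = (z == 0).
Proof.
apply/idP/eqP => [|->]; last by rewrite /quad !mul0mx mxE.
rewrite quad1E psumr_eq0 => [/allP z0|i _]; last exact: sqr_ge0.
apply/rowP => i; rewrite mxE; apply/eqP; rewrite -sqrf_eq0.
exact: z0 (mem_index_enum _).
Qed.

(** The form is [|z C|^2]; this turns the constraint [z C = 0] into a level set of a continuous
    quadratic form. *)
Lemma quad_ker (R : realDomainType) m p (C : 'M[R]_(m, p)) (z : 'rV_m) :
  (quad (C *m C^T) z == 0) = (z *m C == 0).
Proof.
by rewrite -quad1_eq0 /quad mulmx1 trmx_mul !mulmxA.
Qed.

Lemma quadZ (R : comNzRingType) m (B : 'M[R]_m) a z :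
  quad B (a *: z) = a ^+ 2 * quad B z.
Proof.
by rewrite /quad linearZ /= -!scalemxAl -scalemxAr scalerA !mxE expr2.
Qed.

Lemma continuous_quad (R : realType) m (B : 'M[R]_m) :
  continuous (quad B : 'rV[R]_m -> R).
Proof.
have -> : quad B = fun z => \sum_i (\sum_j z 0 j * B j i) * z 0 i.
  by apply/funext => z; rewrite /quad mxE; apply: eq_bigr => i _; rewrite !mxE.
move=> z; apply: (@cvg_big _ _ _ _ _ add_continuous _ (nbhs z)) => i _.
apply: cvgM; last exact: coord_continuous.
apply: (@cvg_big _ _ _ _ _ add_continuous _ (nbhs z)) => j _.
by apply: cvgM; [exact: coord_continuous | exact: cvg_cst].
Qed.

(** The unit sphere of the kernel is compact, so the form attains its maximum there. Both sides
    being quadratic in [w], scaling extends the bound to the whole kernel. *)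
Lemma quad_max_ker (R : realType) m p (C : 'M[R]_(m, p)) (B : 'M[R]_m)
    (w0 : 'rV[R]_m) :
  w0 != 0 -> w0 *m C = 0 ->
  exists2 z : 'rV[R]_m, quad 1%:M z = 1 /\ z *m C = 0 &
    forall w, w *m C = 0 -> quad B w <= quad B z * quad 1%:M w.
Proof.
move=> w0N0 w0C.
pose S := [set z : 'rV[R]_m | quad 1%:M z = 1 /\ quad (C *m C^T) z = 0]%classic.
have SN (w : 'rV[R]_m) :
    w != 0 -> w *m C = 0 -> S ((Num.sqrt (quad 1%:M w))^-1 *: w).
  move=> wN0 wC; have q0 : quad 1%:M w != 0 by rewrite quad1_eq0.
  split; rewrite quadZ.
    by rewrite exprVn sqr_sqrtr ?quad1_ge0 // mulVf.
  by apply/eqP; rewrite mulf_eq0 quad_ker wC eqxx orbT.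
have S0 : (S !=set0)%classic.
  by exists ((Num.sqrt (quad 1%:M w0))^-1 *: w0); exact: SN.
have Sclosed : closed S.
  have clq B' c : closed (quad B' @^-1` [set x | x = c] : set 'rV[R]_m)%classic.
    apply: (@preimage_closed _ _ (quad B') _ _ (@closed_eq R c)) => z _.
    exact: continuous_quad.
  exact: closedI (clq _ _) (clq _ _).
have Scompact : compact S.
  apply: (subclosed_compact Sclosed
    (@rV_compact _ _ (fun=> `[(-1 : R), 1]%classic) _)) => [_|z [z1 _] i] /=.
    exact: segment_compact.
  rewrite in_itv /= -ler_norml -(@expr_le1 _ 2) // real_normK ?num_real //.
  rewrite -z1 quad1E (bigD1 i) //= lerDl.
  by rewrite sumr_ge0 // => j _; exact: sqr_ge0.
have [z zS zmax] := compact_EVT_max S0 Scompact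
  (@continuous_subspaceT _ _ S _ (@continuous_quad _ _ B)).
have [z1 /eqP] := set_mem zS; rewrite quad_ker => /eqP zC.
exists z => // w wC; have [->|wN0] := eqVneq w 0.
  by rewrite /quad !mul0mx mxE mulr0.
have wq : 0 < quad 1%:M w by rewrite lt_def quad1_eq0 wN0 quad1_ge0.
have := zmax _ (mem_set (SN w wN0 wC)).
by rewrite quadZ exprVn sqr_sqrtr ?quad1_ge0 // ler_pdivrMl 1?mulrC.
Qed.

Lemma quadD (R : comNzRingType) m (B : 'M[R]_m) z w t : B^T = B ->
  quad B (z + t *: w) = quad B z + t * (bil B z w) *+ 2 + t ^+ 2 * quad B w.
Proof.
move=> Bsym; have bC : (w *m B *m z^T) 0 0 = bil B z w.
  by rewrite -[w *m _ *m _]trmx11 !trmx_mul trmxK Bsym /bil mulmxA.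
rewrite /quad linearD linearZ /= !mulmxDl !mulmxDr -!scalemxAl -!scalemxAr.
have DE (X Y : 'M[R]_1) : (X + Y) 0 0 = X 0 0 + Y 0 0 by rewrite mxE.
have ZE c (X : 'M[R]_1) : (c *: X) 0 0 = c * X 0 0 by rewrite mxE.
by rewrite !(DE, ZE) bC /bil; ring.
Qed.

(* The form [s |x|^2 - B(x, x)] is nonnegative along [z + t w] and vanishes at
   [z], so its linear term in [t] vanishes: [s] is the Lagrange multiplier. *)
Lemma quad_max_bil (R : realFieldType) m (B : 'M[R]_m) z w s :
  B^T = B -> quad B z = s * quad 1%:M z ->
  (forall t, quad B (z + t *: w) <= s * quad 1%:M (z + t *: w)) ->
  bil B z w = s * bil 1%:M z w.
Proof.
move=> Bsym zs maxz; pose b := s * bil 1%:M z w - bil B z w.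
pose c := s * quad 1%:M w - quad B w.
have ge0 t : 0 <= t * b *+ 2 + t ^+ 2 * c.
  have := maxz t; rewrite !quadD ?trmx1 // zs /b /c -subr_ge0.
  by congr (0 <= _); ring.
suff : b = 0 by rewrite /b; lra.
(* With [b = - (t * k)], [ge0 t] becomes [0 <= t ^+ 2 * (c - 2 * k)], whose last factor is negative;
   hence [t], and with it [b], vanishes. *)
pose k := `|c| + 1; have k_gt : 0 < k by rewrite /k ltr_wpDl.
have ck : c < k by rewrite /k ltr_pwDr ?ler_norm.
pose t := - b / k; have bE : b = - (t * k) by rewrite /t mulfVK ?opprK ?gt_eqF.
have := ge0 t; rewrite bE => t2.
have : t ^+ 2 <= 0 by nra.
rewrite le_eqVlt ltNge sqr_ge0 orbF sqrf_eq0 => /eqP ->.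
by rewrite mul0r oppr0.
Qed.

(** * First-order perturbation of symmetric eigenvectors *)

Lemma sym_fredholm (F : fieldType) m (L : 'M[F]_m) (r : 'rV[F]_m) :
  L^T = L -> (forall w : 'rV[F]_m, w *m L = 0 -> bil 1%:M r w = 0) ->
  (r <= L)%MS.
Proof.
move=> Lsym rL; rewrite submxE; apply/eqP/rowP => j.
transitivity ((r *m col j (cokermx L)) 0 0).
  by rewrite colE mulmxA -colE [RHS]mxE.
(* Symmetry puts the transposed columns of the cokernel in the left kernel of [L], to which [r] is
   orthogonal. *)
have := rL (col j (cokermx L))^T.
rewrite /bil mulmx1 trmxK => ->; first by rewrite mxE.
apply: trmx_inj; rewrite trmx_mul trmxK Lsym colE mulmxA.
by rewrite mulmx_coker mul0mx trmx0.
Qed.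

(** The two equations are the real and [eps] parts of the eigenvector equation for [z0 + eps z1]
    with eigenvalue [s + eps t]. The final bound makes [t] the top of the form of [B] on the
    eigenspace, which also yields real eigenvalues of [B] when [A = 0]. *)
Lemma sym_eigen_perturb (R : realType) m (A B : 'M[R]_m) s (w0 : 'rV[R]_m) :
  A^T = A -> B^T = B -> w0 != 0 -> w0 *m A = s *: w0 ->
  exists (z0 z1 : 'rV[R]_m) t, [/\ quad 1%:M z0 = 1, z0 *m A = s *: z0,
    z0 *m B + z1 *m A = t *: z0 + s *: z1 &
    forall w, w *m A = s *: w -> quad B w <= t * quad 1%:M w].
Proof.
move=> Asym Bsym w0N0 w0A.
have kerE (w : 'rV[R]_m) : (w *m (A - s%:M) = 0) <-> (w *m A = s *: w).
  by rewrite mulmxBr mul_mx_scalar; split=> [/subr0_eq //|->]; rewrite subrr.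
have [z0 [z0q z0A] z0max] := quad_max_ker B w0N0 ((kerE _).2 w0A).
set t := quad B z0 in z0max.
(* The [eps] part reads [z1 (A - s) = t z0 - z0 B], so it is solvable once the right side lies in
   this row space. *)
have : (t *: z0 - z0 *m B <= A - s%:M)%MS.
  apply: sym_fredholm => [|w wA]; first by rewrite linearB /= Asym tr_scalar_mx.
  have := @quad_max_bil _ _ B z0 w t Bsym.
  rewrite z0q mulr1 => /(_ erefl) h.
  rewrite /bil mulmx1 mulmxBl -scalemxAl mxE [X in _ + X]mxE [X in X + _]mxE.
  rewrite -/(bil B z0 w) h => [|c]; first by rewrite /bil mulmx1 subrr.
  by apply: z0max; rewrite mulmxDl -scalemxAl z0A wA scaler0 addr0.
case/submxP => z1 z1E; exists z0, z1, t; split; [by []|exact/kerE| |]; last first.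
  by move=> w /kerE; exact: z0max.
rewrite -[z1 *m A](subrK (s *: z1)).
move: z1E; rewrite mulmxBr mul_mx_scalar => <-.
by rewrite addrA [z0 *m B + _]addrC subrK.
Qed.

(** * Singular triples as eigenvectors of a symmetric block matrix *)

Definition symblock {R : nmodType} {m n} (A : 'M[R]_(m, n)) : 'M[R]_(m + n) :=
  block_mx 0 A A^T 0.

Lemma tr_symblock (R : nmodType) m n (A : 'M[R]_(m, n)) :
  (symblock A)^T = symblock A.
Proof. by rewrite tr_block_mx !trmx0 trmxK. Qed.

Lemma mul_symblock (R : comNzRingType) m n (A : 'M[R]_(m, n)) u v :
  row_mx u v *m symblock A = row_mx (v *m A^T) (u *m A) :> 'rV_(m + n).
Proof. by rewrite mul_row_block !mulmx0 add0r addr0. Qed.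

Lemma quad_symblock (R : comNzRingType) m n (A : 'M[R]_(m, n)) u v :
  quad (symblock A) (row_mx u v) = (u *m A *m v^T) 0 0 *+ 2.
Proof.
rewrite /quad mul_symblock tr_row_mx mul_row_col mxE mulr2n; congr (_ + _).
by rewrite -[v *m _ *m _]trmx11 !trmx_mul !trmxK mulmxA.
Qed.

Lemma symblock_eigen (R : realType) m n (A : 'M[R]_(m, n)) : A != 0 ->
  exists (z : 'rV[R]_(m + n)) s,
    [/\ z != 0, s != 0 & z *m symblock A = s *: z].
Proof.
move=> AN0.
have /existsP[i riN0] : [exists i, row i A != 0].
  apply: contraT; rewrite negb_exists => /forallP h; case/negP: AN0.
  apply/eqP/row_matrixP => i; rewrite row0; apply/eqP.
  by have := h i; rewrite negbK.
(* The form takes the value [2 |row i A|^2] at [w], so its maximum on the unit sphere is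
   positive. *)
pose w : 'rV[R]_(m + n) := row_mx (delta_mx 0 i) (row i A).
have wq : 0 < quad (symblock A) w.
  rewrite quad_symblock -rowE pmulrn_lgt0 //.
  have : 0 < quad 1%:M (row i A) by rewrite lt_def quad1_eq0 riN0 quad1_ge0.
  by rewrite /quad mulmx1.
have wN0 : w != 0 by apply: contraTneq wq => ->; rewrite /quad !mul0mx mxE ltxx.
(* Perturbing the zero matrix, for which every vector has eigenvalue 0, gives an eigenvector of
   [symblock A] for its largest eigenvalue [t]. *)
have [|z [z1 [t [zq _ zE zmax]]]] :=
  @sym_eigen_perturb R _ 0 (symblock A) 0 w (trmx0 _ _ _) (tr_symblock A) wN0.
  by rewrite mulmx0 scale0r.
exists z, t; split.
- by rewrite -quad1_eq0 zq oner_eq0.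
- apply: contraTneq (zmax w _) => [->|]; last by rewrite mulmx0 scale0r.
  by rewrite mul0r -ltNge.
- by move: zE; rewrite mulmx0 scale0r !addr0.
Qed.

(** * Householder completion and deflation over a commutative ring *)

Lemma householder (S : comNzRingType) n (u : 'rV[S]_n.+1) c :
  u *m u^T = 1%:M -> c * (1 - u 0 0) = 1 ->
  exists Q : 'M[S]_n.+1, [/\ Q^T = Q, Q *m Q = 1%:M & delta_mx 0 0 *m Q = u].
Proof.
move=> u1 cu; pose e : 'rV[S]_n.+1 := delta_mx 0 0; pose w := u - e.
have ee : e *m e^T = 1%:M.
  by rewrite trmx_delta mul_delta_mx; apply/rowP => i; rewrite !mxE !ord1.
have eu : e *m u^T = (u 0 0)%:M.
  by rewrite -rowE; apply/rowP => i; rewrite !mxE !ord1.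
have ue : u *m e^T = (u 0 0)%:M.
  by rewrite -[u]trmxK -trmx_mul eu tr_scalar_mx trmxK.
have ww : w *m w^T = (2 * (1 - u 0 0))%:M.
  rewrite /w linearB /= mulmxBl !mulmxBr u1 ue eu ee -!raddfB /=.
  by congr (_%:M); ring.
have ew : e *m w^T = (u 0 0 - 1)%:M.
  by rewrite /w linearB /= mulmxBr eu ee -raddfB.
have wE : e + w = u by rewrite /w addrC subrK.
(* This is the reflection along [w]: since [w w^T = 2 (1 - u 0 0)], the usual coefficient
   [2 / |w|^2] is [c], with no division by 2. *)
clearbody w; exists (1%:M - c *: (w^T *m w)); split.
- by rewrite linearB linearZ /= tr_scalar_mx trmx_mul trmxK.
- rewrite mulmxBl !mulmxBr !mul1mx mulmx1 -!scalemxAl -!scalemxAr scalerA.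
  rewrite mulmxA -(mulmxA _ w) ww mul_mx_scalar -scalemxAl scalerA.
  have -> : c * c * (2 * (1 - u 0 0)) = 2 * c.
    by transitivity (2 * c * (c * (1 - u 0 0))); [ring | rewrite cu mulr1].
  by rewrite mulrDl mul1r scalerDl opprB addrK subrK.
- rewrite mulmxBr mulmx1 -scalemxAr mulmxA ew mul_scalar_mx scalerA.
  by rewrite -[u 0 0 - 1]opprB mulrN cu scaleN1r opprK.
Qed.

Definition has_svd (S : comNzRingType) n (M : 'M[S]_n) : Prop :=
  exists U Sigma V : 'M[S]_n,
    [/\ M = U *m Sigma *m V^T,
        U^T *m U = 1%:M,
        V^T *m V = 1%:M
      & is_diag_mx Sigma].

Lemma has_svd_block (S : comNzRingType) n (a : S) (M : 'M[S]_n) :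
  has_svd M -> has_svd (block_mx (a%:M : 'M_1) 0 0 M).
Proof.
case=> U [D [V [ME UU VV Ddiag]]].
exists (block_mx 1%:M 0 0 U), (block_mx a%:M 0 0 D), (block_mx 1%:M 0 0 V).
split.
- rewrite tr_block_mx !mulmx_block !(mul0mx, mulmx0, mulmx1, mul1mx, trmx0).
  by rewrite !(addr0, add0r, mul0mx) tr_scalar_mx mulmx1 -ME.
- rewrite tr_block_mx !mulmx_block !(mul0mx, mulmx0, mulmx1, mul1mx, trmx0).
  by rewrite !(addr0, add0r) tr_scalar_mx UU -scalar_mx_block.
- rewrite tr_block_mx !mulmx_block !(mul0mx, mulmx0, mulmx1, mul1mx, trmx0).
  by rewrite !(addr0, add0r) tr_scalar_mx VV -scalar_mx_block.
- by rewrite is_diag_block_mx // !eqxx Ddiag scalar_mx_is_diag.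
Qed.

Lemma has_svd_conj (S : comNzRingType) n (P Q M : 'M[S]_n) :
  P^T *m P = 1%:M -> Q^T *m Q = 1%:M ->
  has_svd M -> has_svd (P *m M *m Q^T).
Proof.
move=> PP QQ [U [D [V [-> UU VV Ddiag]]]].
exists (P *m U), D, (Q *m V); split=> //.
- by rewrite trmx_mul !mulmxA.
- by rewrite trmx_mul mulmxA -(mulmxA _ _ P) PP mulmx1.
- by rewrite trmx_mul mulmxA -(mulmxA _ _ Q) QQ mulmx1.
Qed.

(** In the bases given by [P] and [Q], the two equations clear the first row and the first column of
    [P M Q] off the diagonal. *)
Lemma svd_deflate (S : comNzRingType) n (M P Q : 'M[S]_(1 + n)) a :
  P^T = P -> P *m P = 1%:M -> Q^T = Q -> Q *m Q = 1%:M ->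
  let u : 'rV[S]_(1 + n) := delta_mx 0 0 *m P in
  let v : 'rV[S]_(1 + n) := delta_mx 0 0 *m Q in
  u *m M = a *: v -> v *m M^T = a *: u ->
  (forall N : 'M[S]_n, has_svd N) -> has_svd M.
Proof.
move=> Psym PP Qsym QQ u v uM vM IH.
pose e : 'rV[S]_(1 + n) := delta_mx 0 0.
pose N := P *m M *m Q.
have -> : M = P *m N *m Q^T.
  by rewrite /N Qsym !mulmxA PP mul1mx -mulmxA QQ mulmx1.
apply: has_svd_conj; rewrite ?Psym ?Qsym //.
have eN : e *m N = a *: e.
  by rewrite !mulmxA -/u uM -scalemxAl /v -mulmxA QQ mulmx1.
have eNT : e *m N^T = a *: e.
  by rewrite !trmx_mul Psym Qsym !mulmxA -/v vM -scalemxAl /u -mulmxA PP mulmx1.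
clearbody N; have N0 i : N 0 i = a * (i == 0)%:R.
  by have /rowP/(_ i) := eN; rewrite -rowE !mxE eqxx.
have N0' i : N i 0 = a * (i == 0)%:R.
  by have /rowP/(_ i) := eNT; rewrite -rowE !mxE eqxx.
rewrite -[N]submxK.
have l0 : lshift n (0 : 'I_1) = 0 by exact: val_inj.
have -> : ulsubmx N = a%:M.
  by apply/matrixP => i j; rewrite !mxE !ord1 l0 N0 eqxx mulr1.
have -> : ursubmx N = 0.
  by apply/matrixP => i j; rewrite !mxE !ord1 l0 N0 mulr0.
have -> : dlsubmx N = 0.
  by apply/matrixP => i j; rewrite !mxE !ord1 l0 N0' mulr0.
exact: has_svd_block.
Qed.

Lemma has_svd_singular_pair (S : comNzRingType) n (M : 'M[S]_(1 + n))
    (u v : 'rV[S]_(1 + n)) a :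
  (forall x : S, exists c, c * (1 - x) = 1 \/ c * (1 + x) = 1) ->
  u *m u^T = 1%:M -> v *m v^T = 1%:M ->
  u *m M = a *: v -> v *m M^T = a *: u ->
  (forall N : 'M[S]_n, has_svd N) -> has_svd M.
Proof.
move=> Sloc uu vv uM vM IH.
have completion (w : 'rV[S]_(1 + n)) : w *m w^T = 1%:M ->
    exists Q : 'M[S]_(1 + n),
      [/\ Q^T = Q, Q *m Q = 1%:M & delta_mx 0 0 *m Q = w].
  move=> ww; have [c [wc|wc]] := Sloc (w 0 0).
    exact: householder ww wc.
  (* When [1 + w 0 0] is the invertible one, reflect onto [- w] and change the sign of the
     reflection. *)
  have [||Q [Qsym QQ eQ]] := @householder _ _ (- w) c.
  - by rewrite linearN /= mulNmx mulmxN opprK.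
  - by rewrite mxE opprK.
  exists (- Q); split.
  - by rewrite linearN /= Qsym.
  - by rewrite mulNmx mulmxN opprK.
  - by rewrite mulmxN eQ opprK.
have [P [Psym PP Pu]] := completion u uu.
have [Q [Qsym QQ Qv]] := completion v vv.
by apply: (@svd_deflate S n M P Q a) => //; rewrite Pu Qv.
Qed.

(** * Dual units, dual norms and singular triples of dual matrices *)

Lemma inv_sqr0 (S : comNzRingType) (c x y e : S) : e * e = 0 -> c * x = 1 ->
  c * (1 - c * y * e) * (x + e * y) = 1.
Proof. by move=> e2 cx; ring: e2 cx. Qed.

(** First-order expansion of the inverse square root; writing the [e] part as [y + y] avoids halving
    in [S]. *)
Lemma rsqrt_sqr0 (S : comNzRingType) (c x y e : S) : e * e = 0 ->
  c ^+ 2 * x = 1 ->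
  (c * (1 - c ^+ 2 * y * e)) ^+ 2 * (x + e * (y + y)) = 1.
Proof. by move=> e2 cx; ring: e2 cx. Qed.

(* The dual numbers enter only through [k], [e] and the two hypotheses; an
   abstract [D] also prevents unification from unfolding [{poly %/ 'X^2}]. *)
Section Dual.
Variables (R : realType) (D : comNzRingType) (k : {rmorphism R -> D}) (e : D).
Hypothesis e2 : e * e = 0.
Hypothesis kP : forall x, exists ab : R * R, x = k ab.1 + e * k ab.2.
Implicit Types (a b : R).

Definition dual_mx m n (A B : 'M[R]_(m, n)) : 'M[D]_(m, n) :=
  map_mx k A + e *: map_mx k B.

Lemma dual_mxP m n (M : 'M[D]_(m, n)) : exists A B, M = dual_mx A B.
Proof.
have /choice[f fE] (ij : 'I_m * 'I_n) := kP (M ij.1 ij.2).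
exists (\matrix_(i, j) (f (i, j)).1), (\matrix_(i, j) (f (i, j)).2).
by apply/matrixP => i j; rewrite !mxE (fE (i, j)).
Qed.

Lemma dual_mxM m n p (A B : 'M[R]_(m, n)) (C E : 'M[R]_(n, p)) :
  dual_mx A B *m dual_mx C E = dual_mx (A *m C) (A *m E + B *m C).
Proof.
rewrite /dual_mx mulmxDl !mulmxDr -!scalemxAl -!scalemxAr scalerA e2 scale0r.
by rewrite addr0 -!map_mxM -addrA -scalerDr -map_mxD.
Qed.

Lemma tr_dual_mx m n (A B : 'M[R]_(m, n)) :
  (dual_mx A B)^T = dual_mx A^T B^T.
Proof. by rewrite /dual_mx linearD linearZ /= !map_trmx. Qed.

Lemma dual_mxZ m n a b (A B : 'M[R]_(m, n)) :
  (k a + e * k b) *: dual_mx A B = dual_mx (a *: A) (b *: A + a *: B).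
Proof.
apply/matrixP => i j; rewrite !mxE !rmorphD !rmorphM.
by ring: e2.
Qed.

Lemma dual_unit a b : a != 0 -> exists c : D, c * (k a + e * k b) = 1.
Proof.
move=> a0; exists (k a^-1 * (1 - k a^-1 * k b * e)).
by apply: inv_sqr0; rewrite // -rmorphM mulVf ?rmorph1.
Qed.

Lemma dual_rsqrt a b : 0 < a -> exists c : D, c ^+ 2 * (k a + e * k b) = 1.
Proof.
move=> a0; pose r : D := k (Num.sqrt a)^-1.
exists (r * (1 - r ^+ 2 * k (b / 2) * e)).
rewrite {2}(splitr b) rmorphD; apply: rsqrt_sqr0 => //.
rewrite /r -rmorphXn -rmorphM exprVn sqr_sqrtr ?ltW //.
by rewrite mulVf ?rmorph1 ?gt_eqF.
Qed.

(** The real parts of [1 - x] and [1 + x] sum to 2, so one is nonzero, which makes that dual number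
    a unit. *)
Lemma dual_local (x : D) : exists c, c * (1 - x) = 1 \/ c * (1 + x) = 1.
Proof.
have [[a b] /= ->] := kP x.
have [a1|a1] := eqVneq (1 - a) 0.
  have [|c cE] := @dual_unit (1 + a) b; first by apply/eqP; lra.
  by exists c; right; move: cE; rewrite rmorphD rmorph1 -addrA.
have [|c cE] := @dual_unit (1 - a) (- b); first by [].
by exists c; left; move: cE; rewrite rmorphB rmorph1 rmorphN mulrN opprD addrA.
Qed.

Lemma dual_singular_real m n (A B : 'M[R]_(m, n)) : A != 0 ->
  exists (u : 'rV[D]_m) (v : 'rV[D]_n) l,
    [/\ u *m u^T = 1%:M, v *m v^T = 1%:M, u *m dual_mx A B = l *: v
      & v *m (dual_mx A B)^T = l *: u].
Proof.
move=> /symblock_eigen[w [s [wN0 sN0 wE]]].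
have [z0 [z1 [t [zq zA zB _]]]] :=
  sym_eigen_perturb (tr_symblock A) (tr_symblock B) wN0 wE.
move: zq zA zB; rewrite -[z0]hsubmxK -[z1]hsubmxK.
move: (lsubmx z0) (rsubmx z0) (lsubmx z1) (rsubmx z1) => u0 v0 u1 v1.
rewrite !mul_symblock !scale_row_mx !add_row_mx => zq.
move=> /eq_row_mx[vA uA] /eq_row_mx[vB uB].
pose u := dual_mx u0 u1; pose v := dual_mx v0 v1.
pose l := k s + e * k t.
have uM : u *m dual_mx A B = l *: v.
  by rewrite dual_mxM dual_mxZ uA uB.
have vM : v *m (dual_mx A B)^T = l *: u.
  by rewrite tr_dual_mx dual_mxM dual_mxZ vA vB.
have [c cl] := @dual_unit s t sN0.
(* Both norms times [l] equal the scalar [u M v^T], and [l] is a unit because [s != 0]. *)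
have uu_vv : u *m u^T = v *m v^T.
  have : l *: (u *m u^T) = l *: (v *m v^T).
    by rewrite !scalemxAl -uM -vM -[LHS]trmx11 !trmx_mul !trmxK mulmxA.
  by move=> /(congr1 ( *:%R c)); rewrite !scalerA cl !scale1r.
(* The same argument over the reals gives [|u0| = |v0|], while [|u0|^2 + |v0|^2 = 1]. *)
have uu_gt0 : 0 < quad 1%:M u0.
  have : quad 1%:M u0 = quad 1%:M v0.
    apply: (mulfI sN0).
    have <- : bil 1%:M (v0 *m A^T) u0 = s * quad 1%:M u0.
      by rewrite vA /bil /quad !mulmx1 -scalemxAl mxE.
    have <- : bil 1%:M (u0 *m A) v0 = s * quad 1%:M v0.
      by rewrite uA /bil /quad !mulmx1 -scalemxAl mxE.
    by rewrite /bil !mulmx1 -[v0 *m _ *m _]trmx11 !trmx_mul !trmxK mulmxA.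
  move: zq; rewrite {1}/quad mulmx1 tr_row_mx mul_row_col [LHS]mxE.
  by rewrite /quad !mulmx1 => zq qE; rewrite -qE in zq; lra.
(* [b] is the [e] part of [u u^T], so [c'] normalises [u], and also [v] by [uu_vv]. *)
pose b := (u0 *m u1^T + u1 *m u0^T) 0 0.
have [c' c'E] := @dual_rsqrt (quad 1%:M u0) b uu_gt0.
have uu1 : c' ^+ 2 *: (u *m u^T) = 1%:M.
  rewrite /u tr_dual_mx dual_mxM; apply/rowP => i; rewrite !ord1.
  rewrite [RHS]mxE eqxx -c'E [LHS]mxE /dual_mx mxE [X in X + _]mxE.
  by rewrite [X in _ + X]mxE [X in e * X]mxE /quad mulmx1.
exists (c' *: u), (c' *: v), l; split.
- by rewrite linearZ /= -scalemxAl -scalemxAr scalerA -expr2.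
- by rewrite linearZ /= -scalemxAl -scalemxAr scalerA -expr2 -uu_vv.
- by rewrite -scalemxAl uM !scalerA mulrC.
- by rewrite -scalemxAl vM !scalerA mulrC.
Qed.

Lemma dual_singular m n (M : 'M[D]_(m, n)) : M != 0 ->
  exists (u : 'rV[D]_m) (v : 'rV[D]_n) l,
    [/\ u *m u^T = 1%:M, v *m v^T = 1%:M, u *m M = l *: v & v *m M^T = l *: u].
Proof.
have [A [B ->]] := dual_mxP M.
have [->|AN0 _] := eqVneq A 0; last exact: dual_singular_real.
have -> : dual_mx 0 B = e *: dual_mx B 0.
  by rewrite /dual_mx !map_mx0 add0r scaler0 addr0.
have [->|BN0 _] := eqVneq B 0.
  by rewrite /dual_mx !map_mx0 add0r !scaler0 eqxx.
(* A singular triple of the real matrix [B] serves [e B] once its value is multiplied by [e]. *)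
have [u [v [l [uu vv uM vM]]]] := dual_singular_real 0 BN0.
exists u, v, (e * l); split=> //.
  by rewrite -scalemxAr uM scalerA.
by rewrite linearZ -scalemxAr vM scalerA.
Qed.

Lemma dual_svd n (M : 'M[D]_n) : has_svd M.
Proof.
elim: n M => [|n IH] M.
  exists 1%:M, 0, 1%:M; split; last by apply/is_diag_mxP => -[].
  - by rewrite [LHS]thinmx0 [RHS]thinmx0.
  - by rewrite [LHS]thinmx0 [RHS]thinmx0.
  - by rewrite [LHS]thinmx0 [RHS]thinmx0.
have [->|/dual_singular[u [v [l [uu vv uM vM]]]]] := eqVneq M 0.
  exists 1%:M, 0, 1%:M; split; rewrite ?trmx1 ?mulmx1 ?mul1mx //.
  by apply/is_diag_mxP => i j; rewrite mxE.
exact: (has_svd_singular_pair dual_local uu vv uM vM IH).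
Qed.
End Dual.

Theorem mainTheorem1 (R : realType) (n : nat) (n_gt0 : (0 < n)%N)
    (M : 'M[dual R]_n) :
  exists U Sigma V : 'M[dual R]_n,
    [/\ M = U *m Sigma *m V^T,
        U^T *m U = 1%:M,
        V^T *m V = 1%:M
      & is_diag_mx Sigma].
Proof.
apply: (@dual_svd R (dual R) (in_alg (dual R)) (eps R)).
  by rewrite -expr2 dual_sqr0.
by move=> x; have [ab [-> _]] := dual_repr x; exists ab; rewrite mulr_algr.
Qed.
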